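(* Let $k\ge1$ and let $\mathcal{H}$ be an arrangement of $2k+1$ hyperplanes $h_i=\{\vec x\in\mathbb{R}^k:\langle\vec n_i,\vec x\rangle=b_i\}$ in $\mathbb{R}^k$ in general position, and let $\mathbb{F}$ be a field. If $\mathrm{char}(\mathbb{F})\ne 2$, then for every polynomial $p\in\mathbb{F}[x_1,\ldots,x_{2k+1}]$, \[\Pr_s[p(s)\neq f_{\mathcal{H}}(s)]\ \ge\ \frac12-\frac{10\deg_{\mathbb{F}}(p)}{\sqrt{2k+1}},\] where $s$ is uniform over $\{-1,1\}^{2k+1}$. When $\mathbb{F}=\mathbb{F}_2$, the same bound holds with the sign vectors encoded as elements of $\{0,1\}^{2k+1}$ (identifying $-1$ with $0$ and $1$ with $1$) and $s$ uniform over $\{0,1\}^{2k+1}$.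
   Context: $f_{\mathcal{H}}:\{-1,1\}^{2k+1}\to\{0,1\}$ is defined by $f_{\mathcal{H}}(s)=1$ iff there exists $\vec x\in\mathbb{R}^k$ with $\mathrm{sign}(\langle\vec x,\vec n_i\rangle-b_i)=s_i$ for all $i$; its values are viewed as elements $0,1\in\mathbb{F}$. The arrangement is in general position if any $j\le k$ of the hyperplanes intersect in an affine subspace of dimension $k-j$ and any $k+1$ of them have empty intersection. $\deg_{\mathbb{F}}(p)$ is the degree of $p$. *)

(* Defs.v *)
From mathcomp Require Import all_boot all_order all_algebra.
From mathcomp Require Import boolp classical_sets reals.
From mathcomp Require Import mpoly.

Set Implicit Arguments.
Unset Strict Implicit.
Unset Printing Implicit Defensive.

Import Order.TTheory GRing.Theory Num.Theory.

Local Open Scope classical_set_scope.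
Local Open Scope ring_scope.

Definition dot (R : realType) (k : nat) (u v : 'rV[R]_k) : R :=
  \sum_(j < k) u 0 j * v 0 j.

Record arrangement (R : realType) (k m : nat) := Arrangement {
  normal : 'I_m -> 'rV[R]_k;
  offset : 'I_m -> R;
  normal_neq0 : forall i, normal i != 0
}.

Definition hyperplane (R : realType) (k m : nat) (H : arrangement R k m)
    (i : 'I_m) : set 'rV[R]_k :=
  [set x | dot (normal H i) x = offset H i].

Definition affine_subspace_of_dim (R : realType) (k d : nat)
    (A : set 'rV[R]_k) : Prop :=
  exists (x0 : 'rV[R]_k) (V : {vspace 'rV[R]_k}),
    \dim V = d /\ A = [set x | x - x0 \in V].

Definition general_position (R : realType) (k m : nat)
    (H : arrangement R k m) : Prop :=
  (forall J : {set 'I_m}, (#|J| <= k)%N ->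
     affine_subspace_of_dim (k - #|J|)
       (\bigcap_(i in [set` J]) hyperplane H i)) /\
  (forall J : {set 'I_m}, #|J| = k.+1 ->
     \bigcap_(i in [set` J]) hyperplane H i = set0).

(* A sign vector is stored as s : {ffun 'I_m -> bool}, true standing for 1 and
   false for -1; [sign_val] is the encoding in {-1,1}, [bit_val] the one in
   {0,1}. *)
Definition sign_val (A : pzRingType) (c : bool) : A := if c then 1 else -1.

Definition bit_val (A : pzRingType) (c : bool) : A := if c then 1 else 0.

(* Num.sg 0 = 0, so only points lying on no hyperplane realize a sign vector. *)
Definition fH (R : realType) (k m : nat) (H : arrangement R k m)
    (s : {ffun 'I_m -> bool}) : bool :=
  `[< exists x : 'rV[R]_k, forall i : 'I_m,
        Num.sg (dot x (normal H i) - offset H i) = sign_val R (s i) >].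

Definition unif_prob (R : realType) (T : finType) (E : pred T) : R :=
  #|[pred t | E t]|%:R / #|T|%:R.

(* Total degree, with the convention that the zero polynomial has degree 0. *)
Definition mdegree (F : fieldType) (m : nat) (p : {mpoly F[m]}) : nat :=
  (msize p).-1.

(* The probability that p(s) <> f_H(s), where enc : bool -> F encodes the
   coordinates of s as elements of F. *)
Definition error_prob (R : realType) (k m : nat) (H : arrangement R k m)
    (F : fieldType) (enc : bool -> F) (p : {mpoly F[m]}) : R :=
  unif_prob R (fun s : {ffun 'I_m -> bool} =>
    p.@[fun i => enc (s i)] != (fH H s)%:R).

(* Main.v *)
Require Import Defs.
From mathcomp Require Import all_boot all_order all_algebra.
From mathcomp Require Import boolp classical_sets reals.
From mathcomp Require Import mpoly.
From mathcomp Require Import zify ring lra.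

Set Implicit Arguments.
Unset Strict Implicit.
Unset Printing Implicit Defensive.

Import Order.TTheory GRing.Theory Num.Theory.

(* Call [S] the set of realized sign vectors. Neither [S] nor its complement
   shatters a set of k+1 coordinates: k+1 normals in R^k are linearly dependent,
   which rules out a sign pattern on them, and around the common point of any k
   hyperplanes all their sign patterns occur while the other k+1 signs are
   constant. Hence every function g on [S], and every function on its complement,
   is given by a polynomial of degree at most k, say u and v. Where p agrees with
   [f_H], g = p u + (1 - p) v, so every function on the agreement set has degree at
   most k + deg p. By linear algebra the agreement set has at most
   \sum_(i <= k + deg p) C(2k+1, i) <= 2^(2k) + deg p * C(2k+1, k) elements. *)

(** * Binomial estimates *)

(** By symmetry ['C(2 * k + 1, k.+1)] equals the central coefficient, and past the middle the ratio
    of consecutive coefficients is at most 1. *)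
Lemma bin_tail_le_central k i : 'C(2 * k + 1, k.+1 + i) <= 'C(2 * k + 1, k).
Proof.
elim: i => [|i IH].
  have E : 2 * k + 1 - k = k.+1 by lia.
  by rewrite addn0 -E bin_sub //; lia.
apply: leq_trans IH; rewrite (addnS k.+1).
rewrite -(@leq_pmul2l (k.+1 + i).+1) // mul_bin_left.
by apply: leq_mul => //; lia.
Qed.

(** Squaring keeps the estimate in the naturals. The factor [2 * k + 3] lets the induction close:
    [rec] reduces the step to 4 (2k+3) (2k+5) <= 16 (k+2)^2, that is, 60 <= 64. *)
Lemma bin_central_sqr_le k : 'C(2 * k + 1, k) ^ 2 * (2 * k + 3) <= 4 ^ (2 * k + 1).
Proof.
elim: k => // k IH.
have rec : (k + 2) * 'C(2 * k.+1 + 1, k.+1) = 2 * (2 * k + 3) * 'C(2 * k + 1, k).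
  have -> : 2 * k.+1 + 1 = (2 * k + 1).+2 by lia.
  have E1 := mul_bin_diag (2 * k + 1).+2 k.
  have E2 := mul_bin_down (2 * k + 1).+1 k.
  rewrite (_ : (2 * k + 1).+1 - k = k + 2) in E2; last lia.
  apply/eqP; rewrite -(@eqn_pmul2l k.+1) //; apply/eqP.
  rewrite mulnCA -[k.+1 * 'C(_, _)]E1 mulnCA -E2 /=; ring.
have -> : 4 ^ (2 * k.+1 + 1) = 16 * 4 ^ (2 * k + 1).
  by rewrite (_ : 2 * k.+1 + 1 = 2 + (2 * k + 1)) ?expnD //; lia.
rewrite -(@leq_pmul2l ((k + 2) ^ 2)) ?expn_gt0 ?addn2 // -addn2.
rewrite mulnA -expnMn rec.
move: IH; set c := 'C(_, _); set X := 4 ^ _ => IH.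
apply: (@leq_trans (4 * (2 * k + 3) * (2 * k + 5) * (c ^ 2 * (2 * k + 3)))).
  by rewrite leq_eqVlt; apply/orP; left; apply/eqP; rewrite !expnMn; ring.
apply: leq_trans (leq_mul (leqnn _) IH) _; rewrite mulnA leq_mul2r; apply/orP; right.
have -> : 4 * (2 * k + 3) * (2 * k + 5) = 16 * (k * k) + 64 * k + 60 by ring.
have -> : (k + 2) ^ 2 * 16 = 16 * (k * k) + 64 * k + 64 by ring.
lia.
Qed.

(** Complementation exchanges the sets of size at most k with those of size at least k+1. *)
Lemma card_subsets_half k :
  2 * #|[set J : {set 'I_(2 * k + 1)} | #|J| <= k]%SET| = 2 ^ (2 * k + 1).
Proof.
set P := [set J | _]%SET.
have PC : #|~: P| = #|P|.
  rewrite -(card_imset _ (can_inj (@finset.setCK 'I_(2 * k + 1)))).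
  congr #|pred_of_set _|; apply/finset.setP => J; apply/imsetP/idP => [[K]|].
    by rewrite !inE => KP ->; have := cardsC K; rewrite card_ord; lia.
  rewrite !inE => JP; exists (~: J)%SET; rewrite ?finset.setCK // !inE.
  by have := cardsC J; rewrite card_ord; lia.
by rewrite mul2n -addnn -[in X in _ + X]PC cardsC -cardsT -powersetT card_powerset cardsT card_ord.
Qed.

(** Each of the d layers of sizes k+1, ..., k+d has at most a central binomial number of sets. *)
Lemma card_subsets_le k d :
  #|[set J : {set 'I_(2 * k + 1)} | #|J| <= k + d]%SET| <=
    #|[set J : {set 'I_(2 * k + 1)} | #|J| <= k]%SET| + d * 'C(2 * k + 1, k).
Proof.
elim: d => [|d IH]; first by rewrite mul0n !addn0.
set A := [set J | _]%SET.
have sub : A \subset [set J : {set 'I_(2 * k + 1)} | #|J| <= k + d]%SET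
   :|: [set J : {set 'I_(2 * k + 1)} | #|J| == k.+1 + d]%SET.
  by apply/fintype.subsetP => J; rewrite !inE; lia.
apply: leq_trans (subset_leq_card sub) _; rewrite cardsU card_draws card_ord.
apply: leq_trans (leq_subr _ _) _.
by rewrite mulSn [leqRHS]addnCA [leqLHS]addnC leq_add ?bin_tail_le_central.
Qed.

Local Open Scope ring_scope.

(** * Multilinear polynomials on the cube *)

Section DegreeOnSubsets.
Variables (F : fieldType) (n : nat).
Notation cube := {ffun 'I_n -> bool}.
Implicit Types (E : pred cube) (g h : cube -> F) (J : {set 'I_n}) (s : cube).

(* The multilinear monomial [\prod_(j in J) x_j] at the 0/1 point [s]. *)
Definition monom J s : F := (J \subset [set j | s j])%:R.

(** Only the values on [E] are constrained, so the degree may drop when [E] shrinks. *)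
Definition degree_le_on E d g := exists c : {set 'I_n} -> F,
  forall s, E s -> g s = \sum_(J : {set 'I_n} | (#|J| <= d)%N) c J * monom J s.

Lemma eq_degree_le_on E d g h :
  (forall s, E s -> g s = h s) -> degree_le_on E d h -> degree_le_on E d g.
Proof. by move=> gh [c Hc]; exists c => s Es; rewrite gh // Hc. Qed.

Lemma degree_le_onS E E' d g :
  (forall s, E s -> E' s) -> degree_le_on E' d g -> degree_le_on E d g.
Proof. by move=> EE' [c Hc]; exists c => s Es; apply: Hc; apply: EE'. Qed.

Lemma degree_le_onW E d d' g :
  (d <= d')%N -> degree_le_on E d g -> degree_le_on E d' g.
Proof.
move=> dd' [c Hc]; exists (fun J : {set 'I_n} => if (#|J| <= d)%N then c J else 0) => s Es.
rewrite Hc // (big_mkcond (fun J : {set 'I_n} => (#|J| <= d)%N)) [RHS]big_mkcond /=.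
apply: eq_bigr => J _; case: ifP => [Jd|_]; first by rewrite (leq_trans Jd dd').
by case: ifP => // _; rewrite mul0r.
Qed.

Lemma degree_le_onD E d g h : degree_le_on E d g -> degree_le_on E d h ->
  degree_le_on E d (fun s => g s + h s).
Proof.
move=> [c Hc] [c' Hc']; exists (fun J => c J + c' J) => s Es.
by rewrite Hc // Hc' // -big_split /=; apply: eq_bigr => J _; rewrite mulrDl.
Qed.

Lemma degree_le_onZ E d a g :
  degree_le_on E d g -> degree_le_on E d (fun s => a * g s).
Proof.
move=> [c Hc]; exists (fun J => a * c J) => s Es.
by rewrite Hc // mulr_sumr; apply: eq_bigr => J _; rewrite mulrA.
Qed.

Lemma degree_le_on_sum E d (I : Type) (r : seq I) (P : pred I)
    (G : I -> cube -> F) :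
  (forall i, P i -> degree_le_on E d (G i)) ->
  degree_le_on E d (fun s => \sum_(i <- r | P i) G i s).
Proof.
move=> HG; elim: r => [|i r IH].
  exists (fun=> 0) => s _; rewrite big_nil big1 // => J _; exact: mul0r.
case Pi: (P i).
  apply: (@eq_degree_le_on _ _ _ (fun s => G i s + \sum_(i <- r | P i) G i s)).
    by move=> s _; rewrite big_cons Pi.
  by apply: degree_le_onD => //; apply: HG.
by apply: eq_degree_le_on IH => s _; rewrite big_cons Pi.
Qed.

Lemma degree_le_on_monom E J : degree_le_on E #|J| (monom J).
Proof.
exists (fun K => (K == J)%:R) => s _.
rewrite (bigD1 J) //= eqxx mul1r big1 ?addr0 // => K /andP[_ /negbTE ->].
exact: mul0r.
Qed.

Lemma monom0 s : monom finset.set0 s = 1.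
Proof. by rewrite /monom finset.sub0set. Qed.

Lemma monomU J K s : monom (J :|: K) s = monom J s * monom K s.
Proof. by rewrite /monom finset.subUset -natrM mulnb. Qed.

Lemma degree_le_on_cst E a : degree_le_on E 0 (fun=> a).
Proof.
apply: (@eq_degree_le_on _ _ _ (fun s => a * monom finset.set0 s)).
  by move=> s _; rewrite monom0 mulr1.
by apply: degree_le_onZ; rewrite -(@cards0 'I_n); apply: degree_le_on_monom.
Qed.

(** Since x_j^2 = x_j at 0/1 points, the product of two monomials is the monomial of the union. *)
Lemma degree_le_onM E d e g h : degree_le_on E d g -> degree_le_on E e h ->
  degree_le_on E (d + e) (fun s => g s * h s).
Proof.
move=> [c Hc] [c' Hc'].
apply: (@eq_degree_le_on _ _ _ (fun s => \sum_(J : {set 'I_n} | (#|J| <= d)%N)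
   \sum_(K : {set 'I_n} | (#|K| <= e)%N) c J * (c' K * monom (J :|: K) s))).
  move=> s Es; rewrite Hc // Hc' // mulr_suml; apply: eq_bigr => J _.
  rewrite mulr_sumr; apply: eq_bigr => K _; rewrite monomU; ring.
apply: degree_le_on_sum => J Jd; apply: degree_le_on_sum => K Ke.
do 2!apply: degree_le_onZ; apply: degree_le_onW (degree_le_on_monom _ _).
by apply: leq_trans (leq_add Jd Ke); rewrite cardsU leq_subr.
Qed.

Lemma degree_le_on_prod E (I : Type) (r : seq I) (e : I -> nat)
    (G : I -> cube -> F) :
  (forall i, degree_le_on E (e i) (G i)) ->
  degree_le_on E (\sum_(i <- r) e i) (fun s => \prod_(i <- r) G i s).
Proof.
move=> HG; elim: r => [|i r IH].
  rewrite big_nil; apply: eq_degree_le_on (degree_le_on_cst _ 1) => s _.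
  by rewrite big_nil.
rewrite big_cons.
apply: eq_degree_le_on (degree_le_onM (HG i) IH) => s _.
by rewrite big_cons.
Qed.

Lemma degree_le_onX E d e g :
  degree_le_on E d g -> degree_le_on E (d * e) (fun s => g s ^+ e).
Proof.
move=> Hg; elim: e => [|e IH].
  by rewrite muln0; apply: eq_degree_le_on (degree_le_on_cst _ 1).
by rewrite mulnS; apply: eq_degree_le_on (degree_le_onM Hg IH) => s _; exact: exprS.
Qed.

(** Every encoding of a bit is affine in its 0/1 value, so signs and bits are treated at once. *)
Lemma degree_le_on_coord E (enc : bool -> F) (j : 'I_n) :
  degree_le_on E 1 (fun s => enc (s j)).
Proof.
apply: (@eq_degree_le_on _ _ _
  (fun s => enc false + (enc true - enc false) * monom [set j]%SET s)).
  move=> s _; rewrite /monom finset.sub1set inE; case: (s j) => /=; ring.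
apply: degree_le_onD; first exact: degree_le_onW (degree_le_on_cst _ _).
by apply: degree_le_onZ; rewrite -(cards1 j); apply: degree_le_on_monom.
Qed.

Lemma degree_le_on_meval E (enc : bool -> F) (p : {mpoly F[n]}) :
  degree_le_on E (mdegree p) (fun s => p.@[fun i => enc (s i)]).
Proof.
apply: (@eq_degree_le_on _ _ _ (fun s => \sum_(m <- msupp p | m \in msupp p)
    p@_m * \prod_i enc (s i) ^+ m i)).
  by move=> s _; rewrite mevalE [LHS]big_seq_cond; apply: eq_bigl => m; rewrite andbT.
apply: degree_le_on_sum => m mp; apply: degree_le_onZ.
apply: (@degree_le_onW _ (mdeg m)).
  (* For nonzero [p], [msize p] exceeds the degree by one, hence the strict bound on [mdeg m]. *)
  by have := msize_mdeg_lt mp; rewrite /mdegree; lia.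
rewrite mdegE; apply: degree_le_on_prod => i.
by rewrite -[X in degree_le_on _ X]mul1n; apply/degree_le_onX/degree_le_on_coord.
Qed.

(** Interpolation: the indicator of a point is a product of n affine functions of one coordinate
    each. *)
Lemma degree_le_on_all E g : degree_le_on E n g.
Proof.
apply: (@eq_degree_le_on _ _ _
   (fun s => \sum_a g a * \prod_i (s i == a i)%:R)).
  move=> s _; rewrite (bigD1 s) //= [X in g s * X]big1 => [|i _]; last by rewrite eqxx.
  rewrite mulr1 big1 ?addr0 // => a as_; have [i si] : exists i, s i != a i.
    apply/existsP; apply: contraR as_; rewrite negb_exists => /forallP H.
    by apply/eqP/ffunP => i; have := H i; rewrite negbK => /eqP.
  by rewrite (bigD1 i) //= (negbTE si) mul0r mulr0.
apply: degree_le_on_sum => a _; apply: degree_le_onZ.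
have le_n : (\sum_(i < n) 1 <= n)%N by rewrite sum1_card card_ord.
apply: (degree_le_onW le_n); apply: degree_le_on_prod => i.
exact: (degree_le_on_coord _ (fun b => (b == a i)%:R)).
Qed.

(** Both products have the same leading monomial, which cancels: the bound is one below the number
    of factors. *)
Lemma degree_le_on_prod_diff E (c : 'I_n -> F) (j : 'I_n) (r : seq 'I_n) :
  degree_le_on E (size r) (fun s => \prod_(i <- j :: r) (s i)%:R -
     \prod_(i <- j :: r) ((s i)%:R - c i)).
Proof.
have deg1 i (a : F) : degree_le_on E 1 (fun s => (s i)%:R - a).
  exact: (degree_le_on_coord _ (fun b => b%:R - a)).
elim: r j => [|j' r IH] j.
  apply: eq_degree_le_on (degree_le_on_cst _ (c j)) => s _.
  by rewrite !big_seq1; ring.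
apply: (@eq_degree_le_on _ _ _ (fun s => (s j)%:R *
  (\prod_(i <- j' :: r) (s i)%:R - \prod_(i <- j' :: r) ((s i)%:R - c i))
   + c j * \prod_(i <- j' :: r) ((s i)%:R - c i))).
  by move=> s _; rewrite !(big_cons _ _ j) /=; ring.
apply: degree_le_onD.
  rewrite /= -add1n; apply: degree_le_onM (IH _).
  exact: (degree_le_on_coord _ (fun b => b%:R)).
apply: degree_le_onZ; rewrite -[size _]/(size (j' :: r)) -sum1_size.
exact: degree_le_on_prod.
Qed.

Lemma monomE J s : monom J s = \prod_(j <- enum J) (s j)%:R.
Proof.
rewrite /monom big_enum /=; case: fintype.subsetP => [H|H].
  by rewrite big1 // => j /H; rewrite inE => ->.
have [j jJ sj] : exists2 j, j \in J & ~~ s j.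
  apply/exists_inP; apply: contra_notT H; rewrite negb_exists_in => /forall_inP H j jJ.
  by rewrite inE; have := H j jJ; rewrite negbK.
by rewrite (bigD1 j) //= (negbTE sj) mul0r.
Qed.

(** The missed pattern [a] is given on all coordinates, but only its values on [J] matter. *)
Definition shatters_no_set_of_size E d := forall J, #|J| = d ->
  exists a : cube, forall s, E s -> exists2 j, j \in J & s j != a j.

(* A pattern [a] missing on [J] makes [\prod_(j in J) (x_j - (1 - a_j))] vanish
   on [E], so that [\prod_(j in J) x_j] has degree less than [#|J|] there. *)
Lemma degree_le_on_unshattered E d g :
  shatters_no_set_of_size E d.+1 -> degree_le_on E d g.
Proof.
move=> HE.
have monom_reduce J : #|J| = d.+1 -> degree_le_on E d (monom J).
  move=> Jd; have [a Ha] := HE J Jd.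
  have eJ : size (enum J) = d.+1 by rewrite -cardE.
  case def_e: (enum J) eJ => [//|j r] [<-].
  apply: eq_degree_le_on (degree_le_on_prod_diff E (fun i => (~~ a i)%:R) j r) => s Es.
  have [i iJ si] := Ha s Es.
  rewrite monomE -def_e [X in _ - X](_ : _ = 0) ?subr0 // big_enum (bigD1 i) //=.
  by rewrite (_ : s i = ~~ a i) ?subrr ?mul0r //; move: si; case: (s i) (a i) => [] [].
(* Strong induction on |J|: reducing a (d+1)-subset J' of J to degree d turns the monomial of J into
   a combination of monomials of [L :|: (J :\: J')], each smaller than J. *)
have monom_le m J : #|J| = m -> degree_le_on E d (monom J).
  elim/ltn_ind: m J => m IH J Jm; have [md|dm] := leqP m d.
    by apply: degree_le_onW (degree_le_on_monom _ _); rewrite Jm.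
  pose J' := [set j in take d.+1 (enum J)]%SET.
  have J'd : #|J'| = d.+1.
    rewrite cardsE (card_uniqP _) ?take_uniq ?enum_uniq // size_takel //.
    by rewrite -cardE Jm.
  have sJ'J : J' \subset J.
    by apply/fintype.subsetP => j; rewrite inE => /mem_take; rewrite mem_enum.
  have [c Hc] := monom_reduce J' J'd.
  apply: (@eq_degree_le_on _ _ _ (fun s => \sum_(L : {set 'I_n} | (#|L| <= d)%N)
      c L * monom (L :|: (J :\: J')) s)).
    move=> s Es; rewrite -[in LHS](finset.setID J J') (finset.setIidPr sJ'J) monomU Hc //.
    by rewrite mulr_suml; apply: eq_bigr => L _; rewrite monomU mulrA.
  apply: degree_le_on_sum => L Ld; apply: degree_le_onZ; apply: IH (erefl _).
  have := cardsU L (J :\: J'); have := cardsID J' J.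
  rewrite (finset.setIidPr sJ'J); lia.
have [c Hc] := degree_le_on_all E g.
apply: eq_degree_le_on Hc _; apply: degree_le_on_sum => J _.
by apply: degree_le_onZ; apply: monom_le (erefl _).
Qed.

(** The indicators of the points of [E] are independent and lie in the span of the monomials. In
    matrix form, the identity of size |E| factors through the monomials. *)
Lemma card_le_degree E D : (forall g, degree_le_on E D g) ->
  (#|[pred s | E s]| <= #|[set J : {set 'I_n} | (#|J| <= D)%N]%SET|)%N.
Proof.
move=> HE; set P := [set J : {set _} | _]%SET.
have /fin_all_exists[c Hc] := fun a : cube => HE (fun s => (s == a)%:R).
pose A := \matrix_(i < #|[pred s | E s]|, j < #|P|)
  monom (enum_val j) (enum_val i).
pose B := \matrix_(j < #|P|, i < #|[pred s | E s]|)
  c (enum_val i) (enum_val j).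
apply: (@mulmx1_min F _ _ A B); apply/matrixP => i i'; rewrite !mxE.
have Ei := enum_valP i; rewrite inE in Ei.
rewrite -(inj_eq enum_val_inj) Hc //.
rewrite (eq_bigl (mem P)); last by move=> J; rewrite !inE.
rewrite [RHS]big_enum_val /=.
by apply: eq_bigr => j _; rewrite !mxE mulrC.
Qed.

End DegreeOnSubsets.

(** * Sign vectors of hyperplane arrangements *)

Section Arrangements.
Variables (R : realType) (k : nat).

Lemma dotC (u v : 'rV[R]_k) : dot u v = dot v u.
Proof. by apply: eq_bigr => j _; rewrite mulrC. Qed.

Lemma dotDl (u v w : 'rV[R]_k) : dot (u + v) w = dot u w + dot v w.
Proof. by rewrite /dot -big_split; apply: eq_bigr => j _; rewrite mxE mulrDl. Qed.

Lemma dotZl a (u w : 'rV[R]_k) : dot (a *: u) w = a * dot u w.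
Proof. by rewrite /dot mulr_sumr; apply: eq_bigr => j _; rewrite mxE mulrA. Qed.

Lemma dot_mulmx (u v : 'rV[R]_k) : dot u v = (u *m v^T) 0 0.
Proof. by rewrite mxE; apply: eq_bigr => j _; rewrite mxE. Qed.

Lemma linear_dependence m (n_ : 'I_m -> 'rV[R]_k) (J : {set 'I_m}) :
  (k < #|J|)%N -> exists2 c : 'I_m -> R, (exists2 j, j \in J & c j != 0) &
    forall x, \sum_(j in J) c j * dot x (n_ j) = 0.
Proof.
move=> kJ; pose M := \matrix_(i < #|J|) n_ (enum_val i).
have : kermx M != 0.
  rewrite kermx_eq0 /row_free neq_ltn.
  by rewrite (leq_ltn_trans (rank_leq_col M) kJ).
case/rowV0Pn => v /sub_kermxP vM v0.
have j0 : 'I_#|J| by exact: (Ordinal (leq_ltn_trans (leq0n _) kJ)).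
(* [enum_rank_in] takes a default element of [J]; the coefficients outside [J] are arbitrary. *)
pose rk := enum_rank_in (enum_valP j0).
exists (fun j => v 0 (rk j)).
  have /rV0Pn[i vi] := v0; exists (enum_val i); first exact: enum_valP.
  by rewrite /rk enum_valK_in.
move=> x; rewrite big_enum_val /=.
transitivity ((v *m M *m x^T) 0 0); last by rewrite vM mul0mx mxE.
rewrite -mulmxA mxE; apply: eq_bigr => i _; rewrite /rk enum_valK_in; congr (_ * _).
rewrite dotC dot_mulmx mxE [RHS]mxE; apply: eq_bigr => j _.
by rewrite [M _ _]mxE.
Qed.

(* Along a linear relation [c] between the normals, [\sum_j c_j (<x,n_j> - b_j)]
   is a constant, so the signs of [c], or their opposites, are not realized. *)
Lemma fH_unshattered m (H : arrangement R k m) :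
  shatters_no_set_of_size (fH H) k.+1.
Proof.
move=> J Jk.
have [|c [j0 j0J cj0] Hc] := @linear_dependence m (normal H) J; first by rewrite Jk.
wlog t0 : c cj0 Hc / 0 <= \sum_(j in J) c j * offset H j.
  move=> W; have [|t0] := leP 0 (\sum_(j in J) c j * offset H j); first exact: W.
  apply: (W (fun j => - c j)); first by rewrite oppr_eq0.
    by move=> x; under eq_bigr do rewrite mulNr; rewrite sumrN Hc oppr0.
  by under eq_bigr do rewrite mulNr; rewrite sumrN oppr_ge0 ltW.
exists [ffun j => 0 < c j] => s /asboolP[x Hx].
apply/exists_inP; apply: contraT; rewrite negb_exists_in => /forall_inP Hs.
(* With the pattern on [J], every term is nonnegative, and positive at [j0], while the sum equals
   -\sum_j c_j b_j <= 0. *)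
have pos j : j \in J -> 0 <= c j * (dot x (normal H j) - offset H j)
    ?= iff (c j == 0).
  move=> jJ; have := Hx j; have := Hs j jJ; rewrite negbK ffunE => /eqP -> Hsg.
  split; last first.
    rewrite eq_sym mulf_eq0; case: eqP => //= _; rewrite -sgr_eq0 Hx.
    by rewrite /sign_val; case: ifP; rewrite ?oppr_eq0 oner_eq0.
  move: Hsg; case: ltP => cj /= Hsg.
    by rewrite mulr_ge0 ?(ltW cj) // -sgr_ge0 Hsg.
  by rewrite mulr_le0 // -sgr_le0 Hsg lerN10.
have : 0 < \sum_(j in J) c j * (dot x (normal H j) - offset H j).
  rewrite lt_def sumr_ge0 ?andbT; last by move=> j /pos[].
  rewrite psumr_neq0; last by move=> j /pos[].
  apply/hasP; exists j0; rewrite ?mem_index_enum // j0J /=.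
  by rewrite lt_def (pos _ j0J).1 andbT eq_sym (pos _ j0J).2.
under eq_bigr do rewrite mulrBr.
by rewrite sumrB Hc sub0r oppr_gt0 ltNge t0.
Qed.

Lemma sgr_add_small (a e : R) : `|e| < `|a| -> Num.sg (a + e) = Num.sg a.
Proof.
rewrite ltr_norml => /andP[]; case: (ltrgt0P a) => [a0 h1 h2|a0 h1 h2|->]; last lra.
  by rewrite !gtr0_sg //; lra.
by rewrite !ltr0_sg //; lra.
Qed.

(** An injective linear map between spaces of equal dimension k is onto. *)
Lemma dot_system_solvable m (n_ : 'I_m -> 'rV[R]_k) (K : {set 'I_m}) :
  #|K| = k -> (forall w, (forall i, i \in K -> dot w (n_ i) = 0) -> w = 0) ->
  forall t : 'I_m -> R, exists w, forall i, i \in K -> dot w (n_ i) = t i.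
Proof.
move=> Kk inj t.
pose N := \matrix_(a < k, i < #|K|) n_ (enum_val i) 0 a.
have dotN w (i : 'I_#|K|) : (w *m N) 0 i = dot w (n_ (enum_val i)).
  by rewrite mxE; apply: eq_bigr => a _; rewrite mxE.
have freeN : row_free N.
  apply/inj_row_free => w wN; apply: inj => i iK.
  by rewrite -(enum_rankK_in iK iK) -dotN wN mxE.
have fullN : row_full N by rewrite /row_full (eqP freeN) Kk.
have [B BN] := row_fullP fullN.
exists ((\row_i t (enum_val i)) *m B) => i iK.
by rewrite -(enum_rankK_in iK iK) -dotN -mulmxA BN mulmx1 mxE.
Qed.

(* The k hyperplanes outside [J] meet in a vertex; near it all of their 2^k sign
   patterns occur, while the signs on [J] stay fixed. *)
Lemma negfH_unshattered (H : arrangement R k (2 * k + 1)) :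
  general_position H ->
  shatters_no_set_of_size (fun s => ~~ fH H s) k.+1.
Proof.
move=> [gp1 gp2] J Jk; set K := (~: J)%SET.
have Kk : #|K| = k by have := cardsC J; rewrite card_ord /K; lia.
have [|v [V [dimV HV]]] := gp1 K; first by rewrite Kk.
have V0 : V = 0%VS by apply/eqP; rewrite -dimv_eq0 dimV Kk subnn.
have vK i : i \in K -> dot v (normal H i) = offset H i.
  have : (\bigcap_(i in [set` K]) hyperplane H i)%classic v.
    by rewrite HV /= subrr mem0v.
  by move=> vI iK; rewrite dotC; apply: vI.
(* A vector orthogonal to these normals moves [v] inside the intersection, which is a single
   point. *)
have inj w : (forall i, i \in K -> dot w (normal H i) = 0) -> w = 0.
  move=> Hw; have : (\bigcap_(i in [set` K]) hyperplane H i)%classic (v + w).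
    by move=> i /= iK; rewrite /hyperplane /= dotC dotDl vK // Hw // addr0.
  by rewrite HV /= addrAC subrr add0r V0 memv0 => /eqP.
pose a j := dot v (normal H j) - offset H j.
(* Otherwise k+1 hyperplanes would meet at [v]. *)
have aJ j : j \in J -> a j != 0.
  move=> jJ; apply/eqP => aj.
  have := gp2 (j |: K)%SET; rewrite cardsU1 !inE jJ Kk => /(_ erefl) E.
  suff: (set0 : set 'rV[R]_k) v by [].
  rewrite -E => i /=; rewrite !inE => /orP[/eqP ->|iJ]; rewrite /hyperplane /= dotC.
    by apply/eqP; rewrite -subr_eq0; apply/eqP.
  by apply: vK; rewrite inE.
exists [ffun j => 0 < a j] => s sH; apply/exists_inP; apply: contraR sH.
rewrite negb_exists_in => /forall_inP Hs.
(* Moving from [v] along [w] gives the signs of [s] on [K]. The step length 1/(1+S) keeps those on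
   [J]: |<w,n_j>| <= |a_j| S < |a_j| (1+S). *)
have [w Hw] := dot_system_solvable Kk inj (fun i => sign_val R (s i)).
pose S := \sum_(j in J) `|dot w (normal H j)| / `|a j|.
have S0 : 0 <= S by apply: sumr_ge0 => j _; rewrite divr_ge0.
have S1 : 0 < 1 + S by lra.
apply/asboolP; exists (v + (1 + S)^-1 *: w) => i; rewrite dotDl dotZl.
have [iJ|iJ] := boolP (i \in J); last first.
  have iK : i \in K by rewrite inE.
  rewrite vK // Hw // addrAC subrr add0r sgrM (gtr0_sg (x := _^-1)) ?invr_gt0 // mul1r.
  by case: (s i); rewrite /sign_val ?sgrN sgr1.
rewrite addrAC -/(a i) sgr_add_small; last first.
  rewrite normrM gtr0_norm ?invr_gt0 // mulrC ltr_pdivrMr // mulrDr mulr1.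
  have ai : 0 < `|a i| by rewrite normr_gt0 aJ.
  suff : `|dot w (normal H i)| <= `|a i| * S by lra.
  rewrite mulrC -ler_pdivrMr // /S (bigD1 i) //= lerDl.
  by apply: sumr_ge0 => j _; rewrite divr_ge0.
have := Hs i iJ; rewrite negbK ffunE => /eqP ->.
case: (ltrgt0P (a i)) (aJ i iJ) => [ai _|ai _|->]; rewrite ?eqxx // /sign_val.
  by rewrite gtr0_sg.
by rewrite ltr0_sg.
Qed.

End Arrangements.

(** * Error bound *)

(** On the agreement set q is 0 or 1 and so selects between [u], valid where f holds, and [v], valid
    elsewhere. *)
Lemma card_agreement_le (F : fieldType) (n k d : nat) (f : pred {ffun 'I_n -> bool})
    (q : {ffun 'I_n -> bool} -> F) :
  shatters_no_set_of_size f k.+1 ->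
  shatters_no_set_of_size (fun s => ~~ f s) k.+1 ->
  degree_le_on predT d q ->
  (#|[pred s | q s == (f s)%:R]| <=
     #|[set J : {set 'I_n} | (#|J| <= k + d)%N]%SET|)%N.
Proof.
move=> f1 f0 qd; apply: (@card_le_degree F) => g.
have [u Hu] := degree_le_on_unshattered g f1.
have [v Hv] := degree_le_on_unshattered g f0.
set E := fun s => _.
pose ev (c : {set 'I_n} -> F) s :=
  \sum_(J : {set 'I_n} | (#|J| <= k)%N) c J * monom F J s.
have ev_deg c : degree_le_on E k (ev c) by exists c.
have qE : degree_le_on E d q by apply: degree_le_onS qd.
have qE' : degree_le_on E d (fun s => 1 + (-1) * q s).
  apply: degree_le_onD; last exact: degree_le_onZ.
  exact: degree_le_onW (degree_le_on_cst _ _).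
apply: eq_degree_le_on
  (degree_le_onD (degree_le_onM (ev_deg u) qE) (degree_le_onM (ev_deg v) qE')).
move=> s /eqP ->; rewrite /ev; case fs: (f s) => /=.
  by rewrite -Hu //; ring.
by rewrite -Hv ?fs //; ring.
Qed.

(** After squaring, [bin_central_sqr_le] gives this even with 1 in place of 10, as 2k+1 <= 2k+3. *)
Lemma central_bin_bound (R : realType) k :
  'C(2 * k + 1, k)%:R / 2 ^+ (2 * k + 1) <= 10 / Num.sqrt (2 * k + 1)%:R :> R.
Proof.
set r := Num.sqrt _; have r0 : 0 < r by rewrite sqrtr_gt0 ltr0n addn1.
set X : R := 2 ^+ _; have X0 : 0 < X by rewrite exprn_gt0.
rewrite ler_pdivrMr // mulrAC ler_pdivlMr //.
rewrite -(@ler_pXn2r R 2) ?nnegrE ?mulr_ge0 ?ler0n ?(ltW r0) ?(ltW X0) //.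
have X2 : X ^+ 2 = (4 ^ (2 * k + 1))%:R by rewrite /X -natrX -natrX -expnM mulnC expnM.
rewrite !exprMn sqr_sqrtr ?ler0n // X2.
apply: (@le_trans _ _ (4 ^ (2 * k + 1))%:R); last by rewrite ler_peMl ?ler0n //; lra.
rewrite -natrX -natrM ler_nat; apply: leq_trans (bin_central_sqr_le k).
by rewrite leq_mul2l; apply/orP; right; lia.
Qed.

Lemma error_prob_ge (R : realType) (k : nat) (H : arrangement R k (2 * k + 1))
    (F : fieldType) (enc : bool -> F) (p : {mpoly F[2 * k + 1]}) :
  general_position H ->
  error_prob H enc p >= 1 / 2 - 10 * (mdegree p)%:R / Num.sqrt (2 * k + 1)%:R.
Proof.
move=> gp; rewrite /error_prob /unif_prob.
set A := [pred t | _].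
have cT : #|{: {ffun 'I_(2 * k + 1) -> bool}}| = (2 ^ (2 * k + 1))%N.
  by rewrite card_ffun card_bool card_ord.
have agree := card_agreement_le (@fH_unshattered R k _ H) (negfH_unshattered gp)
  (degree_le_on_meval predT enc p).
have {}agree := leq_trans agree (card_subsets_le k (mdegree p)).
have AC : (#|[pred s : {ffun 'I_(2 * k + 1) -> bool} |
    p.@[fun i => enc (s i)] == (fH H s)%:R]| + #|A| = 2 ^ (2 * k + 1))%N.
  rewrite -cT -(cardC [pred s : {ffun 'I_(2 * k + 1) -> bool} |
    p.@[fun i => enc (s i)] == (fH H s)%:R]).
  by congr (_ + _)%N; apply: eq_card => s; rewrite !inE.
(* [a] counts agreements, [b] errors, [c] the sets of size at most k, and [e] bounds the extra
   layers; [N] is 2^(2k+1). *)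
have arith a b c e N :
  (a <= c + e -> a + b = N -> 2 * c = N -> N <= 2 * b + 2 * e)%N by lia.
have key : (2 ^ (2 * k + 1) <=
    2 * #|A| + 2 * (mdegree p * 'C(2 * k + 1, k)))%N.
  exact: arith agree AC (card_subsets_half k).
(* Division by [X], which is 2^(2k+1); here [a] counts errors, [c] is the central coefficient, [d]
   the degree and [r] the square root. *)
have real_arith (a c d r X : R) : 0 < X -> 0 <= d ->
    X <= 2 * a + 2 * (d * c) -> c / X <= 10 / r -> 1 / 2 - 10 * d / r <= a / X.
  move=> X0 d0; rewrite -(ler_pM2r (x := X^-1)) ?invr_gt0 // mulfV ?gt_eqF //.
  move=> aX /(ler_wpM2l d0); nra.
rewrite cT natrX; apply: real_arith (central_bin_bound R k) => //.
  by rewrite exprn_gt0.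
by rewrite -natrX -!natrM -natrD ler_nat.
Qed.

Theorem theorem10 (R : realType) (k : nat) (H : arrangement R k (2 * k + 1)) :
  (1 <= k)%N -> general_position H ->
  (forall F : fieldType, 2%N \notin [pchar F] ->
     forall p : {mpoly F[2 * k + 1]},
       error_prob H (sign_val F) p >=
         1 / 2 - 10 * (mdegree p)%:R / Num.sqrt (2 * k + 1)%:R) /\
  (forall p : {mpoly 'F_2[2 * k + 1]},
       error_prob H (bit_val 'F_2) p >=
         1 / 2 - 10 * (mdegree p)%:R / Num.sqrt (2 * k + 1)%:R).
Proof. by move=> _ gp; split=> *; apply: error_prob_ge. Qed.
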